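(* (Projective Pythagoras' theorem) Let $\mathbb{F}$ be a field of characteristic not $2$ and let $B$ be an invertible symmetric $3\times 3$ matrix over $\mathbb{F}$. Let $\overline{p_1p_2p_3}$ be a tripod in $\mathbb{V}^3=\mathbb{F}^3$ whose $B$-projective quadrances $q_1,q_2,q_3$ and $B$-projective spreads $S_1,S_2,S_3$ are all defined, i.e. writing $p_i=[v_i]$, one has $Q_B(v_i)\neq 0$ for all $i$ and $Q_B(v_i\times_B v_j)\ne 0$ for all $i\neq j$. If $S_1=1$, then $$q_1=q_2+q_3-q_2q_3.$$
   Context: $\mathbb{V}^3$ is the space of row vectors over $\mathbb{F}$. The $B$-scalar product is $v\cdot_B w=vBw^T$ and $Q_B(v)=v\cdot_B v$. The Euclidean vector product is $(x_1,y_1,z_1)\times(x_2,y_2,z_2)=(y_1z_2-y_2z_1,\;x_2z_1-x_1z_2,\;x_1y_2-x_2y_1)$, and the $B$-vector product is $v\times_B w=(v\times w)\,\mathrm{adj}\,B$ with $\mathrm{adj}\,B=(\det B)B^{-1}$. A projective vector $p=[v]$ is the class of a non-zero vector $v$ modulo non-zero scalars. A tripod (projective triangle) $\overline{p_1p_2p_3}$ is a set of three distinct projective vectors $p_i=[v_i]$. The $B$-projective quadrance is $q_B([v],[w])=s_B(v,w)=1-\dfrac{(v\cdot_B w)^2}{Q_B(v)Q_B(w)}$, defined when $Q_B(v),Q_B(w)\neq0$. The $B$-projective quadrances of the tripod are $q_1=q_B(p_2,p_3)$, $q_2=q_B(p_1,p_3)$, $q_3=q_B(p_1,p_2)$. With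 $r_1=[v_2\times_B v_3]$, $r_2=[v_1\times_B v_3]$, $r_3=[v_1\times_B v_2]$ (the $B$-dual), the $B$-projective spreads are $S_1=q_B(r_2,r_3)$, $S_2=q_B(r_1,r_3)$, $S_3=q_B(r_1,r_2)$. *)

(* Defs.v *)
(* Written against MathComp; boolp is used only to turn the existential
   quantifier over scalars in proj_equiv into a boolean relation. *)
From mathcomp Require Import all_boot all_order all_algebra.
From mathcomp Require Import boolp.

Set Implicit Arguments.
Unset Strict Implicit.
Unset Printing Implicit Defensive.

Import GRing.Theory.
Local Open Scope ring_scope.
Local Open Scope quotient_scope.

Section BilinearGeometry.
Variable F : fieldType.
Implicit Types (B : 'M[F]_3) (v w : 'rV[F]_3) (c : F).

Definition dotB B v w : F := (v *m B *m w^T) 0 0.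

Definition quadB B v : F := dotB B v v.

Definition row3 (x y z : F) : 'rV[F]_3 := \row_j [:: x; y; z]`_j.

Definition cross v w : 'rV[F]_3 :=
  let: (x1, y1, z1) := (v 0 0, v 0 1, v 0 2%:R) in
  let: (x2, y2, z2) := (w 0 0, w 0 1, w 0 2%:R) in
  row3 (y1 * z2 - y2 * z1) (x2 * z1 - x1 * z2) (x1 * y2 - x2 * y1).

Definition crossB B v w : 'rV[F]_3 := cross v w *m \adj B.

(* Meaningful only when quadB B v and quadB B w are nonzero. *)
Definition spreadB B v w : F :=
  1 - dotB B v w ^+ 2 / (quadB B v * quadB B w).

Lemma dotBZ B c d v w : dotB B (c *: v) (d *: w) = c * d * dotB B v w.
Proof.
by rewrite /dotB linearZ /= -!scalemxAl -scalemxAr scalerA [LHS]mxE.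
Qed.

Lemma spreadBZ B c d v w : c != 0 -> d != 0 ->
  spreadB B (c *: v) (d *: w) = spreadB B v w.
Proof.
move=> c0 d0; rewrite /spreadB /quadB !dotBZ; congr (1 - _).
have -> : c * c * dotB B v v * (d * d * dotB B w w) =
          (c * d) ^+ 2 * (dotB B v v * dotB B w w).
  by rewrite expr2 mulrACA [c * c * _]mulrACA.
by rewrite exprMn -mulf_div divff ?mul1r // expf_neq0 ?mulf_neq0.
Qed.

Lemma crossE v w :
  [/\ cross v w 0 0 = v 0 1 * w 0 2%:R - w 0 1 * v 0 2%:R,
      cross v w 0 1 = w 0 0 * v 0 2%:R - v 0 0 * w 0 2%:R
    & cross v w 0 2%:R = v 0 0 * w 0 1 - w 0 0 * v 0 1].
Proof. by split; rewrite mxE. Qed.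

Lemma ord3P (P : 'I_3 -> Prop) : P 0 -> P 1 -> P 2%:R -> forall i, P i.
Proof.
move=> P0 P1 P2 [[|[|[|//]]] lti].
- by have -> : Ordinal lti = 0 by apply: val_inj.
- by have -> : Ordinal lti = 1 by apply: val_inj.
- by have -> : Ordinal lti = 2%:R by apply: val_inj.
Qed.

Lemma crossZ c d v w : cross (c *: v) (d *: w) = (c * d) *: cross v w.
Proof.
apply/rowP; elim/ord3P; rewrite !mxE /= mulrBr; congr (_ - _);
  by rewrite mulrACA // [d * c]mulrC.
Qed.

Lemma crossBZ B c d v w :
  crossB B (c *: v) (d *: w) = (c * d) *: crossB B v w.
Proof. by rewrite /crossB crossZ -scalemxAl. Qed.

Lemma cross_eq0 v w : v != 0 -> w != 0 -> cross v w = 0 ->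
  exists2 c, c != 0 & w = c *: v.
Proof.
move=> v0 w0 vw0.
have prop i j : v 0 i * w 0 j = w 0 i * v 0 j.
  have [e0 e1 e2] := crossE v w.
  move: e0 e1 e2; rewrite vw0 !mxE => /esym/subr0_eq e0 /esym/subr0_eq e1
    /esym/subr0_eq e2.
  elim/ord3P: i; elim/ord3P: j.
  - exact: mulrC.
  - exact: e2.
  - exact: esym e1.
  - by rewrite mulrC -e2 mulrC.
  - exact: mulrC.
  - exact: e0.
  - by rewrite mulrC e1 mulrC.
  - by rewrite mulrC -e0 mulrC.
  - exact: mulrC.
have /rV0Pn[i vi0] := v0.
exists (w 0 i / v 0 i); last first.
  by apply/rowP => j; rewrite mxE mulrAC -prop mulrAC divff ?mul1r.
apply: contraNneq w0 => c0; apply/eqP/rowP => j; apply/eqP.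
have wi0 : w 0 i = 0 by rewrite -[LHS](divfK vi0) c0 mul0r.
by have /eqP := prop i j; rewrite wi0 mul0r mulf_eq0 (negbTE vi0) mxE.
Qed.

Lemma crossB_eq0 B v w : B \in unitmx -> crossB B v w = 0 -> cross v w = 0.
Proof.
move=> uB /(congr1 (mulmxr B)) /=.
rewrite /crossB -mulmxA mul_adj_mx mul_mx_scalar mul0mx => /eqP.
by rewrite scaler_eq0 -[\det B == 0]negbK -unitfE -unitmxE uB => /eqP.
Qed.

End BilinearGeometry.

Definition nzvec (F : fieldType) := {v : 'rV[F]_3 | v != 0}.

Section ProjectiveVectors.
Variable F : fieldType.
Implicit Types (B : 'M[F]_3) (v w : nzvec F).

Definition proj_equiv : rel (nzvec F) :=
  fun v w => `[< exists2 c : F, c != 0 & val w = c *: val v >].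

Lemma proj_equiv_refl : reflexive proj_equiv.
Proof. by move=> v; apply/asboolP; exists 1; rewrite ?oner_eq0 ?scale1r. Qed.

Lemma proj_equiv_sym : symmetric proj_equiv.
Proof.
suff sub v w : proj_equiv v w -> proj_equiv w v.
  by move=> v w; apply/idP/idP; apply: sub.
move=> /asboolP[c c0 vw]; apply/asboolP; exists c^-1; first by rewrite invr_eq0.
by rewrite vw scalerA mulVf ?scale1r.
Qed.

Lemma proj_equiv_trans : transitive proj_equiv.
Proof.
move=> w v u /asboolP[c c0 vw] /asboolP[d d0 wu]; apply/asboolP.
by exists (d * c); rewrite ?mulf_neq0 // wu vw scalerA.
Qed.

Canonical proj_equiv_equivRel :=
  EquivRel proj_equiv proj_equiv_refl proj_equiv_sym proj_equiv_trans.

Definition projvec := {eq_quot proj_equiv}.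

Definition pclass v : projvec := \pi_projvec v.

Lemma pclassP v w :
  reflect (exists2 c : F, c != 0 & val w = c *: val v) (pclass v == pclass w).
Proof.
by rewrite /pclass eqmodE; apply: asboolP.
Qed.

Lemma pclass_repr (p : projvec) : pclass (repr p) = p.
Proof. exact: reprK. Qed.

Lemma repr_pclass v :
  exists2 c : F, c != 0 & val (repr (pclass v)) = c *: val v.
Proof. by apply/pclassP; rewrite pclass_repr. Qed.

Definition pquad B (p r : projvec) : F :=
  spreadB B (val (repr p)) (val (repr r)).

Lemma pquadE B v w : pquad B (pclass v) (pclass w) = spreadB B (val v) (val w).
Proof.
rewrite /pquad; have [c c0 ->] := repr_pclass v.
by have [d d0 ->] := repr_pclass w; rewrite spreadBZ.
Qed.

Lemma crossB_neq0 B v w : B \in unitmx -> pclass v != pclass w ->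
  crossB B (val v) (val w) != 0.
Proof.
move=> uB; apply: contraNneq => /(crossB_eq0 uB) vw0; apply/pclassP.
exact: cross_eq0 (valP v) (valP w) vw0.
Qed.

Lemma crossB_repr_neq0 B (p r : projvec) : B \in unitmx -> p != r ->
  crossB B (val (repr p)) (val (repr r)) != 0.
Proof. by move=> uB pr; apply: crossB_neq0; rewrite ?pclass_repr. Qed.

(* [v x_B w] for p = [v] and r = [w]; distinctness of p and r and
   invertibility of B are what make v x_B w nonzero. *)
Definition pcross B (uB : B \in unitmx) (p r : projvec) (pr : p != r) :
    projvec :=
  pclass (Sub (crossB B (val (repr p)) (val (repr r)))
              (crossB_repr_neq0 uB pr)).

Lemma pcrossE B (uB : B \in unitmx) v w (vw : pclass v != pclass w) :
  pcross uB vw = pclass (Sub (crossB B (val v) (val w)) (crossB_neq0 uB vw)).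
Proof.
rewrite /pcross; apply/esym/eqP/pclassP.
have [c c0 ev] := repr_pclass v; have [d d0 ew] := repr_pclass w.
exists (c * d); first by rewrite mulf_neq0.
by rewrite [LHS]SubK [X in _ = _ *: X]SubK ev ew crossBZ.
Qed.

Record tripod := Tripod {
  pt1 : projvec;
  pt2 : projvec;
  pt3 : projvec;
  pt12 : pt1 != pt2;
  pt13 : pt1 != pt3;
  pt23 : pt2 != pt3
}.

Definition pquad1 B (t : tripod) : F := pquad B (pt2 t) (pt3 t).
Definition pquad2 B (t : tripod) : F := pquad B (pt1 t) (pt3 t).
Definition pquad3 B (t : tripod) : F := pquad B (pt1 t) (pt2 t).

Definition dual1 B (uB : B \in unitmx) (t : tripod) := pcross uB (pt23 t).
Definition dual2 B (uB : B \in unitmx) (t : tripod) := pcross uB (pt13 t).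
Definition dual3 B (uB : B \in unitmx) (t : tripod) := pcross uB (pt12 t).

Definition pspread1 B (uB : B \in unitmx) (t : tripod) : F :=
  pquad B (dual2 uB t) (dual3 uB t).
Definition pspread2 B (uB : B \in unitmx) (t : tripod) : F :=
  pquad B (dual1 uB t) (dual3 uB t).
Definition pspread3 B (uB : B \in unitmx) (t : tripod) : F :=
  pquad B (dual1 uB t) (dual2 uB t).

End ProjectiveVectors.

(* Main.v *)
Require Import Defs.
From mathcomp Require Import all_boot all_order all_algebra.
From mathcomp Require Import ring.

Import GRing.Theory.
Local Open Scope ring_scope.

(** Write [a_ij] for the B-scalar product of the representatives [v_i] and
    [v_j].  Since spreads do not depend on the representatives, [S_1 = 1] says
    exactly that the duals [v_1 x_B v_3] and [v_1 x_B v_2] are B-orthogonal.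

    The B-version of the Binet-Cauchy identity, [dotB_crossB], evaluates their
    B-scalar product as [det B * (a_11 a_23 - a_12 a_13)].  As [B] is
    invertible, the hypothesis thus becomes [a_11 a_23 = a_12 a_13], whence
    [[
      a_23^2 / (a_22 a_33) =
        (a_12^2 / (a_11 a_22)) * (a_13^2 / (a_11 a_33)),
    ]]
    that is [1 - q_1 = (1 - q_3) (1 - q_2)], which is the claim.

    The B-version of Binet-Cauchy reduces to the Euclidean one,
    [cross_dot_cross], by moving [B] inside the vector product: for symmetric
    [B], [(v x w) adj B = (v B) x (w B)] by [cross_mulmx], while the matrix of
    the B-scalar product cancels the other adjugate up to [det B]. *)

Lemma sum_ord3 (V : nmodType) (f : 'I_3 -> V) :
  \sum_i f i = f 0 + f 1 + f 2%:R.
Proof.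
rewrite !big_ord_recl big_ord0 addr0 addrA.
by congr (f _ + f _ + f _); apply: val_inj.
Qed.

Lemma det_mx2 (R : comPzRingType) (M : 'M[R]_2) :
  \det M = M 0 0 * M 1 1 - M 0 1 * M 1 0.
Proof.
rewrite (expand_det_row _ 0) !big_ord_recl big_ord0 addr0 /cofactor !det_mx11.
rewrite !mxE /= mul1r mulN1r mulrN.
by congr (_ * M _ _ - M _ _ * M _ _); apply: val_inj.
Qed.

(** Reading the indices modulo 3 absorbs the sign [(-1)^(i+j)] of the cofactor:
    whenever that sign is negative, the cyclic order of the two remaining rows
    and that of the two remaining columns together differ from the increasing
    orders by one transposition. *)
Lemma adj_mx3 (R : comPzRingType) (M : 'M[R]_3) (i j : 'I_3) :
  (\adj M) j i = M (i + 1) (j + 1) * M (i + 2%:R) (j + 2%:R)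
               - M (i + 1) (j + 2%:R) * M (i + 2%:R) (j + 1).
Proof.
(* Indexing the entries by natural numbers lets the various ordinals that
   denote the same index compute to a common form. *)
pose m a b := M (inord a) (inord b).
have mE a b : M a b = m a b by rewrite /m !inord_val.
rewrite mxE /cofactor det_mx2 !mxE !mE.
by elim/ord3P: i; elim/ord3P: j; rewrite /=; ring.
Qed.

(** The coordinates of a vector product are 2 x 2 minors, so a linear map acts
    on vector products through its matrix of 2 x 2 minors, the cofactor
    matrix. *)
Lemma cross_mulmx (F : fieldType) (M : 'M[F]_3) (v w : 'rV[F]_3) :
  cross (v *m M) (w *m M) = cross v w *m (\adj M)^T.
Proof.
have [x0 x1 x2] := crossE v w.
have [y0 y1 y2] := crossE (v *m M) (w *m M).
pose m a b := M (inord a) (inord b).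
have mE a b : M a b = m a b by rewrite /m !inord_val.
apply/rowP; elim/ord3P; rewrite ?(y0, y1, y2) !mxE !sum_ord3 ![_^T _ _]mxE;
  by rewrite !adj_mx3 x0 x1 x2 !mE /=; ring.
Qed.

(** The Binet-Cauchy identity in dimension 3. *)
Lemma cross_dot_cross (F : fieldType) (a b c d : 'rV[F]_3) :
  cross a b *m (cross c d)^T =
  (a *m c^T) *m (b *m d^T) - (a *m d^T) *m (b *m c^T).
Proof.
have [x0 x1 x2] := crossE a b.
have [y0 y1 y2] := crossE c d.
apply/rowP=> i; rewrite !ord1 !mxE !big_ord1 !mxE !sum_ord3.
by rewrite ![_^T _ _]mxE x0 x1 x2 y0 y1 y2; ring.
Qed.

(** Binet-Cauchy for the B-products: [adj B] in the left factor cancels against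
    the matrix of the scalar product and leaves [det B], while [adj B] in the
    right factor turns [c x d] into [(c B) x (d B)], so that the Euclidean
    products of the identity become B-scalar products. *)
Lemma dotB_crossB (F : fieldType) (B : 'M[F]_3) (a b c d : 'rV[F]_3) :
  B^T = B ->
  dotB B (crossB B a b) (crossB B c d) =
  \det B * (dotB B a c * dotB B b d - dotB B a d * dotB B b c).
Proof.
move=> symB.
have dotE v w : v *m (w *m B)^T = (dotB B v w)%:M.
  by rewrite trmx_mul symB mulmxA [LHS]mx11_scalar.
have crossBE : crossB B c d = cross (c *m B) (d *m B).
  by rewrite cross_mulmx /crossB trmx_adj symB.
rewrite {1}/dotB {1}/crossB -[_ *m \adj B *m B]mulmxA mul_adj_mx crossBE.
rewrite mul_mx_scalar -scalemxAl cross_dot_cross !dotE -!scalar_mxM -raddfB.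
by rewrite !mxE mulr1n.
Qed.

Lemma dotBC (F : fieldType) (B : 'M[F]_3) (v w : 'rV[F]_3) :
  B^T = B -> dotB B v w = dotB B w v.
Proof.
move=> symB; have trE (M : 'M[F]_1) : M 0 0 = M^T 0 0 by rewrite mxE.
by rewrite /dotB [RHS]trE !trmx_mul trmxK symB mulmxA.
Qed.

Lemma spreadB_eq1 (F : fieldType) (B : 'M[F]_3) (v w : 'rV[F]_3) :
  quadB B v != 0 -> quadB B w != 0 -> spreadB B v w = 1 -> dotB B v w = 0.
Proof.
move=> Qv Qw /eqP; rewrite /spreadB -subr_eq0 addrAC subrr sub0r oppr_eq0.
rewrite mulf_eq0 invr_eq0 expf_eq0 mulf_eq0 (negPf Qv) (negPf Qw) !orbF /=.
by move/eqP.
Qed.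

Theorem theorem29 (F : fieldType) (charF : 2%N \notin [pchar F])
    (B : 'M[F]_3) (symB : B^T = B) (unitB : B \in unitmx)
    (t : tripod F) (v1 v2 v3 : nzvec F)
    (tv1 : pt1 t = pclass v1) (tv2 : pt2 t = pclass v2)
    (tv3 : pt3 t = pclass v3)
    (Q1 : quadB B (val v1) != 0) (Q2 : quadB B (val v2) != 0)
    (Q3 : quadB B (val v3) != 0)
    (Q23 : quadB B (crossB B (val v2) (val v3)) != 0)
    (Q13 : quadB B (crossB B (val v1) (val v3)) != 0)
    (Q12 : quadB B (crossB B (val v1) (val v2)) != 0) :
  pspread1 unitB t = 1 ->
  pquad1 B t = pquad2 B t + pquad3 B t - pquad2 B t * pquad3 B t.
Proof.
case: t tv1 tv2 tv3 => p1 p2 p3 p12 p13 p23 /= e1 e2 e3.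
rewrite {}e1 {}e2 {}e3 in p12 p13 p23 *.
rewrite /pspread1 /dual2 /dual3 /= !pcrossE pquadE.
rewrite [val _]SubK [X in spreadB _ _ X]SubK.
move=> /(spreadB_eq1 _ _ _ _ Q13 Q12)/eqP.
have detB : \det B != 0 by rewrite -unitfE -unitmxE.
rewrite dotB_crossB // mulf_eq0 (negPf detB) subr_eq0 /= => /eqP.
rewrite (dotBC _ _ (val v3) (val v2)) // (dotBC _ _ (val v3) (val v1)) //.
rewrite -/(quadB B (val v1)) => orth.
rewrite /pquad1 /pquad2 /pquad3 /= !pquadE /spreadB.
(* Eliminating [a_23 = a_12 a_13 / a_11] leaves an identity of rational
   functions in the other products. *)
have -> : dotB B (val v2) (val v3) =
    dotB B (val v1) (val v2) * dotB B (val v1) (val v3) / quadB B (val v1).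
  by rewrite -orth mulrAC divff ?mul1r.
by field; rewrite Q1 Q2 Q3.
Qed.
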